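(* For any time-step size $\Delta t>0$, the sBDF1 algorithm (defined in the context) preserves the discrete maximum bound principle, i.e. $$\|\phi^n\|_\infty\le 1,\qquad\forall\,n\ge 0,$$ provided that the initial data satisfy $\|\phi^0\|_\infty\le 1$.
   Context: The scheme approximates $\phi_t=\alpha\Delta\phi+f(\phi)$ in $\Omega\times(0,T)$, subject to suitable initial and boundary conditions, with $\alpha>0$ and $f$ smooth. There is $B>0$ with $|f'(\xi)|\le B$ for $\xi\in[-1,1]$, $f(1)\le 0$, $f(-1)\ge 0$. Put $\mathcal N(s):=f(s)+Bs$. It is assumed that the continuous problem satisfies the maximum bound principle $|\phi(x,t)|\le 1$ for all $(x,t)\in\Omega\times[0,T]$, and that $|\mathcal N(s)|\le B$ for all $s\in[-1,1]$. Grid functions $u=(u_{i,j})$ live on a uniform two-dimensional Cartesian grid of mesh size $h$, with $\|u\|^2=h^2\sum_{i,j}|u_{i,j}|^2$ and $\|u\|_\infty=\max_{i,j}|u_{i,j}|$. sBDF1 algorithm: given $\phi^n$, set $\widetilde\phi^{\,n+1,(0)}=\phi^n$ and for $m=0,1,\dots$ $$\widetilde\phi^{\,n+1,(m+1)}_{i,j}=\frac{1}{1+\frac{4\alpha\Delta t}{h^2}+2B\Delta t}\Bigl[(1+B\Delta t)\phi^n_{i,j}+\frac{\alpha\Delta t}{h^2}\bigl(\widetilde\phi^{\,n+1,(m)}_{i+1,j}+\widetilde\phi^{\,n+1,(m)}_{i-1,j}+\widetilde\phi^{\,n+1,(m)}_{i,j+1}+\widetilde\phi^{\,n+1,(m)}_{i,j-1}\bigr)+\Delta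 t\,\mathcal N(\widetilde\phi^{\,n+1,(m)}_{i,j})\Bigr].$$ No cut-off is applied. The iteration is terminated once $\|\widetilde\phi^{\,n+1,(m+1)}-\widetilde\phi^{\,n+1,(m)}\|<\varepsilon$, where $\varepsilon=C\min\{\Delta t^2,h^2\}$ with a constant $C$, and $\phi^{n+1}:=\widetilde\phi^{\,n+1,(m_\star)}$, where $m_\star$ is the (finite) stopping index. *)

(* Defs.v *)
From HB Require Import structures.
From mathcomp Require Import all_boot all_order all_algebra.
From mathcomp Require Import all_classical all_reals all_analysis.

Set Implicit Arguments.
Unset Strict Implicit.
Unset Printing Implicit Defensive.

Import Order.TTheory GRing.Theory Num.Theory.
Import numFieldNormedType.Exports.

Local Open Scope classical_set_scope.
Local Open Scope ring_scope.

(* The domain is a rectangle; each of the two axes carries one of these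
   boundary conditions.  The Neumann condition is homogeneous and comes with the
   two usual placements of the grid points. *)
Inductive boundary : Type :=
  | Periodic
  | NeumannCell   (* cell-centred:   ghosts u_{-1} = u_0, u_N = u_{N-1} *)
  | NeumannVertex (* vertex-centred: ghosts u_{-1} = u_1, u_N = u_{N-2} *)
  | Dirichlet.    (* only the interior points are unknowns *)

(* The point of index i on an axis has coordinate (i + offset b) * h. *)
Definition offset (R : realType) (b : boundary) : R :=
  match b with
  | Periodic => 0
  | NeumannCell => 2^-1
  | NeumannVertex => 0
  | Dirichlet => 1
  end.

Definition coord (R : realType) (b : boundary) (h : R) (i : nat) : R :=
  (i%:R + offset R b) * h.

(* Length of a side carrying N grid points of spacing h. *)
Definition side_length (R : realType) (b : boundary) (N : nat) (h : R) : R :=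
  match b with
  | Periodic => N%:R * h
  | NeumannCell => N%:R * h
  | NeumannVertex => (N%:R - 1) * h
  | Dirichlet => (N%:R + 1) * h
  end.

(* A periodic axis is unrolled to the whole line, so that the differential
   equation also holds across the identified endpoints. *)
Definition open_side (R : realType) (b : boundary) (L : R) : set R :=
  if b is Periodic then setT else [set x | 0 < x < L].

Definition closed_side (R : realType) (b : boundary) (L : R) : set R :=
  if b is Periodic then setT else [set x | 0 <= x <= L].

(* Boundary condition for a one-dimensional slice v of the solution, along an
   axis of length L; gv is the corresponding slice of the Dirichlet datum. *)
Definition side_condition (R : realType) (b : boundary) (L : R)
    (gv v : R -> R) : Prop :=
  match b with
  | Periodic => forall x, v (x + L) = v x
  | NeumannCell | NeumannVertex =>
      ((v x - v 0) / x @[x --> 0^'+] --> (0 : R)) /\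
      ((v x - v L) / (x - L) @[x --> L^'-] --> (0 : R))
  | Dirichlet => v 0 = gv 0 /\ v L = gv L
  end.

Definition smooth (R : realType) (f : R -> R) : Prop :=
  forall (k : nat) (x : R), derivable (derive1n k f) x 1.

Definition twice_derivable_at (R : realType) (v : R -> R) (x : R) : Prop :=
  derivable v x 1 /\ derivable (derive1 v) x 1.

Definition laplacian (R : realType) (u : R -> R -> R) (x y : R) : R :=
  derive1n 2 (fun s => u s y) x + derive1n 2 (fun s => u x s) y.

Definition classical_solution (R : realType) (alpha : R) (f : R -> R)
    (bx by_ : boundary) (Lx Ly : R) (g : R -> R -> R -> R) (T : R)
    (phi : R -> R -> R -> R) : Prop :=
  [/\ {within [set p : R * R * R | [/\ closed_side bx Lx p.1.1,
                 closed_side by_ Ly p.1.2 & 0 <= p.2 <= T]],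
        continuous (fun p : R * R * R => phi p.1.1 p.1.2 p.2)},
      (forall x y t, open_side bx Lx x -> open_side by_ Ly y -> 0 < t < T ->
        [/\ derivable (fun s => phi x y s) t 1,
            twice_derivable_at (fun s => phi s y t) x,
            twice_derivable_at (fun s => phi x s t) y &
            derive1 (fun s => phi x y s) t =
              alpha * laplacian (fun x' y' => phi x' y' t) x y
                + f (phi x y t)]),
      (forall y t, closed_side by_ Ly y -> 0 <= t <= T ->
        side_condition bx Lx (fun s => g s y t) (fun s => phi s y t)) &
      (forall x t, closed_side bx Lx x -> 0 <= t <= T ->
        side_condition by_ Ly (fun s => g x s t) (fun s => phi x s t))].

Definition continuous_MBP (R : realType) (alpha : R) (f : R -> R)
    (bx by_ : boundary) (Lx Ly : R) (g : R -> R -> R -> R) (T : R) : Prop :=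
  forall phi : R -> R -> R -> R,
    classical_solution alpha f bx by_ Lx Ly g T phi ->
    (forall x y, closed_side bx Lx x -> closed_side by_ Ly y ->
      `|phi x y 0| <= 1) ->
    forall x y t, open_side bx Lx x -> open_side by_ Ly y -> 0 <= t <= T ->
      `|phi x y t| <= 1.

(* Grid functions are matrices: u i j is the value at the i-th abscissa and the
   j-th ordinate.  The library norm `|u| of a matrix is max_{i,j} |u i j|
   (mx_normrE). *)
Definition l2norm (R : realType) (Nx Ny : nat) (h : R)
    (u : 'M[R]_(Nx, Ny)) : R :=
  Num.sqrt (h ^+ 2 * \sum_(i < Nx) \sum_(j < Ny) `|u i j| ^+ 2).

(* Index of the preceding (resp. following) point on an axis, ghost points
   included; None stands for a point of the Dirichlet boundary. *)
Definition prev_pt (b : boundary) (n : nat) (i : 'I_n.+1) : option 'I_n.+1 :=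
  if i != ord0 then Some (inord i.-1) else
  match b with
  | Periodic => Some ord_max
  | NeumannCell => Some ord0
  | NeumannVertex => Some (inord 1)
  | Dirichlet => None
  end.

Definition next_pt (b : boundary) (n : nat) (i : 'I_n.+1) : option 'I_n.+1 :=
  if i != ord_max then Some (inord i.+1) else
  match b with
  | Periodic => Some ord0
  | NeumannCell => Some ord_max
  | NeumannVertex => Some (inord n.-1)
  | Dirichlet => None
  end.

(* u_{i+1,j} + u_{i-1,j} + u_{i,j+1} + u_{i,j-1}, where gt is the Dirichlet
   datum at the current time. *)
Definition neighbour_sum (R : realType) (bx by_ : boundary) (nx ny : nat)
    (h : R) (gt : R -> R -> R) (u : 'M[R]_(nx.+1, ny.+1))
    (i : 'I_nx.+1) (j : 'I_ny.+1) : R :=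
  let x := coord bx h i in let y := coord by_ h j in
  (if next_pt bx i is Some k then u k j else gt (x + h) y)
  + (if prev_pt bx i is Some k then u k j else gt (x - h) y)
  + (if next_pt by_ j is Some k then u i k else gt x (y + h))
  + (if prev_pt by_ j is Some k then u i k else gt x (y - h)).

Definition Nstab (R : realType) (f : R -> R) (B s : R) : R := f s + B * s.

Definition sBDF1_sweep (R : realType) (alpha : R) (f : R -> R) (B : R)
    (bx by_ : boundary) (nx ny : nat) (h dt : R) (gt : R -> R -> R)
    (phin u : 'M[R]_(nx.+1, ny.+1)) : 'M[R]_(nx.+1, ny.+1) :=
  \matrix_(i, j)
    ((1 + 4 * alpha * dt / h ^+ 2 + 2 * B * dt)^-1 *
     ((1 + B * dt) * phin i j
      + alpha * dt / h ^+ 2 * neighbour_sum bx by_ h gt u i j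
      + dt * Nstab f B (u i j))).

Definition sBDF1_iterate (R : realType) (alpha : R) (f : R -> R) (B : R)
    (bx by_ : boundary) (nx ny : nat) (h dt : R) (gt : R -> R -> R)
    (phin : 'M[R]_(nx.+1, ny.+1)) (m : nat) : 'M[R]_(nx.+1, ny.+1) :=
  iter m (sBDF1_sweep alpha f B bx by_ h dt gt phin) phin.

(* The iteration terminates at the first m whose update is below the tolerance,
   and the last computed iterate, of index m.+1, becomes the new time level.
   The scheme is implicit: the Dirichlet datum is taken at time (n+1) dt. *)
Definition sBDF1_run (R : realType) (alpha : R) (f : R -> R) (B C : R)
    (bx by_ : boundary) (nx ny : nat) (h dt : R) (g : R -> R -> R -> R)
    (phi : nat -> 'M[R]_(nx.+1, ny.+1)) : Prop :=
  forall n : nat,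
    let it := sBDF1_iterate alpha f B bx by_ h dt
                (fun x y => g x y (n.+1%:R * dt)) (phi n) in
    let stop m := l2norm h (it m.+1 - it m)
                    < C * Num.min (dt ^+ 2) (h ^+ 2) in
    exists m : nat,
      [/\ stop m, (forall k : nat, (k < m)%N -> ~ stop k) &
          phi n.+1 = it m.+1].

(* Main.v *)
Require Import Defs.
From HB Require Import structures.
From mathcomp Require Import all_boot all_order all_algebra.
From mathcomp Require Import all_classical all_reals all_analysis.
From mathcomp Require Import ring lra.

Import Order.TTheory GRing.Theory Num.Theory.
Import numFieldNormedType.Exports.

Local Open Scope classical_set_scope.
Local Open Scope ring_scope.

(** A sweep maps the unit ball of the max norm to itself. At a grid point its numerator is at most
    [(1 + B * dt) + 4 * alpha * dt / h ^+ 2 + dt * B] in absolute value, which is exactly its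
    denominator, whatever the size of [dt] ([sBDF1_sweep_bound]). The sweeps start from [phi n], so
    induction on the sweeps, inside an induction on the time levels, gives the theorem. *)

Lemma mx_norm_leP {R : realType} {m n : nat} {M : 'M[R]_(m.+1, n.+1)} {r : R} :
  0 <= r -> reflect (forall i j, `|M i j| <= r) (`|M| <= r).
Proof.
move=> r0; rewrite [`|M|]mx_normrE.
apply: (iffP (bigmax_leP _ _ _ _)) => [[_ M_le] i j|M_le]; first exact: (M_le (i, j)).
by split=> // -[i j] _; apply: M_le.
Qed.

(** Under each boundary condition a neighbour is either a grid value or the Dirichlet datum, so each
    of the four terms is at most [r]. *)
Lemma neighbour_sum_bound (R : realType) (bx by_ : boundary) (nx ny : nat)
    (h r : R) (gt : R -> R -> R) (u : 'M[R]_(nx.+1, ny.+1)) i j :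
  (forall x y, `|gt x y| <= r) -> (forall i j, `|u i j| <= r) ->
  `|neighbour_sum bx by_ h gt u i j| <= 4 * r.
Proof.
move=> gt_le u_le; rewrite /neighbour_sum.
have -> : 4 * r = r + r + r + r by ring.
apply: le_trans (ler_normD _ _) _; apply: lerD; last by case: prev_pt.
apply: le_trans (ler_normD _ _) _; apply: lerD; last by case: next_pt.
apply: le_trans (ler_normD _ _) _; apply: lerD; last by case: prev_pt.
by case: next_pt.
Qed.

(* The weights of the three bounds add up to the denominator:
   (1 + B dt) + 4 alpha dt / h^2 + dt B. *)
Lemma sBDF1_sweep_bound (R : realType) (alpha : R) (f : R -> R) (B : R)
    (bx by_ : boundary) (nx ny : nat) (h dt : R) (gt : R -> R -> R)
    (phin u : 'M[R]_(nx.+1, ny.+1)) :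
  0 <= alpha -> 0 <= B -> 0 <= dt ->
  (forall x y, `|gt x y| <= 1) ->
  (forall s, -1 <= s <= 1 -> `|Nstab f B s| <= B) ->
  `|phin| <= 1 -> `|u| <= 1 ->
  `|sBDF1_sweep alpha f B bx by_ h dt gt phin u| <= 1.
Proof.
move=> alpha0 B0 dt0 gt_le N_le /(mx_norm_leP ler01) phin_le
  /(mx_norm_leP ler01) u_le.
apply/(mx_norm_leP ler01) => i j; rewrite mxE.
have c0 : 0 <= alpha * dt / h ^+ 2 by rewrite !mulr_ge0 ?invr_ge0 ?sqr_ge0.
have Bdt0 : 0 <= B * dt by rewrite mulr_ge0.
have D0 : 0 < 1 + 4 * alpha * dt / h ^+ 2 + 2 * B * dt.
  (* Regrouped, the goal is linear in the products of [c0] and [Bdt0]. *)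
  by rewrite -!mulrA [alpha * _]mulrA; lra.
rewrite normrM gtr0_norm ?invr_gt0 // ler_pdivrMl // mulr1.
(* Written as weights times bounds, the denominator matches the numerator term by term. *)
have -> : 1 + 4 * alpha * dt / h ^+ 2 + 2 * B * dt =
    (1 + B * dt) * 1 + alpha * dt / h ^+ 2 * (4 * 1) + dt * B by ring.
have weighted a x b : 0 <= a -> `|x| <= b -> `|a * x| <= a * b.
  by move=> a0 x_le; rewrite normrM ger0_norm ?ler_wpM2l.
apply: le_trans (ler_normD _ _) _; apply: lerD.
  apply: le_trans (ler_normD _ _) _; apply: lerD; apply: weighted => //.
    exact: addr_ge0.
  exact: neighbour_sum_bound.
by apply: weighted => //; apply: N_le; rewrite -ler_norml.
Qed.

Theorem theorem5p1 (R : realType) (alpha : R) (f : R -> R) (B C T h : R)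
    (bx by_ : boundary) (nx ny : nat) (g : R -> R -> R -> R)
    (halpha : 0 < alpha) (hT : 0 < T) (hh : 0 < h)
    (f_smooth : smooth f)
    (hB : 0 < B)
    (df_bound : forall xi : R, -1 <= xi <= 1 -> `|derive1 f xi| <= B)
    (f_1 : f 1 <= 0) (f_N1 : 0 <= f (-1))
    (g_bound : forall x y t : R, `|g x y t| <= 1)
    (mbp : continuous_MBP alpha f bx by_
             (side_length bx nx.+1 h) (side_length by_ ny.+1 h) g T)
    (N_bound : forall s : R, -1 <= s <= 1 -> `|Nstab f B s| <= B) :
  forall (dt : R), 0 < dt ->
  forall phi : nat -> 'M[R]_(nx.+1, ny.+1),
    sBDF1_run alpha f B C bx by_ h dt g phi ->
    `|phi 0%N| <= 1 ->
    forall n : nat, `|phi n| <= 1.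
Proof.
move=> dt dt0 phi run phi0; elim=> // n phin.
(* The bound holds for inner iterates of every index, hence for the one at which the run stops;
   iterate 0 is [phi n]. *)
have [m [_ _ ->]] := run n; elim: m.+1 => // k IH.
by apply: sBDF1_sweep_bound => //; exact: ltW.
Qed.
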